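(* Let $A>0$ and let $P$ be the Poisson channel under the peak power constraint $A$. Fix $L\in\mathbb N$, $L\ge1$, and put $\lambda^{(n)}=\exp\left[\frac{3A}{2}\left(\frac32-\log n\right)\right]$. Then there exists a sequence of $(n,N^{(n)},L\lambda^{(n)},\lambda^{(n)})$ deterministic identification codes for $P$ (for all sufficiently large $n$) with $$\frac{\log N^{(n)}}{n\log n}\longrightarrow\frac12\qquad(n\to\infty),$$ i.e. achieving linearithmic rate $\dot R=\frac12$. Hence $\dot C_{\mathrm{DI}}(P)=\frac12$.
   Context: Logarithms $\log$ are to base 2; $\exp$ is the natural exponential. The Poisson channel $P$ under peak power constraint $A$ has input alphabet $\mathcal X=[0,A]$ and output alphabet $\mathcal Y=\{0,1,2,\dots\}$, with $P(y|x)=e^{-x}x^y/y!$. Channels are memoryless: on input $x^n=(x_1,\dots,x_n)\in\mathcal X^n$, the output $Y^n$ has independent coordinates with $Y_i\sim W(\cdot|x_i)$; the resulting law is denoted $W^n(\cdot|x^n)$. An $(n,N,\lambda_1,\lambda_2)$ deterministic identification (DI) code for a channel $W:\mathcal X\to\mathcal Y$ is a family $\{(u_i,\mathcal D_i): i\in[N]\}$ with $u_i\in\mathcal X^n$ and $\mathcal D_i\subset\mathcal Y^n$ (regions may overlap) such that for all distinct $i,j\in[N]$: $W^n(\mathcal D_i|u_i)\ge 1-\lambda_1$ and $W^n(\mathcal D_j|u_i)\le\lambda_2$. A number $\dot R>0$ is an achievable linearithmic rate for $W$ if there is a sequence of $(n,N^{(n)},\lambda_1^{(n)},\lambda_2^{(n)})$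 DI codes with $\lambda_1^{(n)},\lambda_2^{(n)}\to0$ and $\frac{\log N^{(n)}}{n\log n}\to\dot R$ as $n\to\infty$. The linearithmic DI capacity $\dot C_{\mathrm{DI}}(W)$ is the largest achievable linearithmic rate. *)

(* Defs.v *)
From HB Require Import structures.
From mathcomp Require Import all_boot all_order all_algebra.
From mathcomp Require Import all_classical all_reals all_analysis.

Set Implicit Arguments.
Unset Strict Implicit.
Unset Printing Implicit Defensive.

Import Order.TTheory GRing.Theory Num.Theory.
Import numFieldNormedType.Exports.

Local Open Scope classical_set_scope.
Local Open Scope ring_scope.

Definition log2 (R : realType) (x : R) : R := ln x / ln 2.

(* A channel from X to the discrete alphabet nat is a map
   W : X -> probability nat R; W(y|x) is W x [set y]. *)

(* W^n(D | x^n): the output coordinates are independent with laws W (x_i).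
   As nat^n is countable, the product law is the sum over D of the product of
   the point masses. *)
Definition memoryless (R : realType) (X : Type) (W : X -> probability nat R)
    (n : nat) (x : n.-tuple X) (D : set (n.-tuple nat)) : \bar R :=
  (\esum_(y in D) \prod_(i < n) W (tnth x i) [set tnth y i])%E.

Definition is_DI_code (R : realType) (X : Type) (W : X -> probability nat R)
    (n N : nat) (lambda1 lambda2 : R)
    (u : 'I_N -> n.-tuple X) (D : 'I_N -> set (n.-tuple nat)) : Prop :=
  forall i j : 'I_N, i != j ->
    ((1 - lambda1)%:E <= memoryless W (u i) (D i))%E /\
    (memoryless W (u i) (D j) <= lambda2%:E)%E.

Definition has_DI_code (R : realType) (X : Type) (W : X -> probability nat R)
    (n N : nat) (lambda1 lambda2 : R) : Prop :=
  exists (u : 'I_N -> n.-tuple X) (D : 'I_N -> set (n.-tuple nat)),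
    is_DI_code W lambda1 lambda2 u D.

(* The value at n = 0 and n = 1 (zero denominator) is junk, irrelevant to
   limits. *)
Definition linearithmic_rate (R : realType) (N : nat -> nat) (n : nat) : R :=
  log2 (N n)%:R / (n%:R * log2 n%:R).

Definition achievable_linearithmic_rate (R : realType) (X : Type)
    (W : X -> probability nat R) (r : R) : Prop :=
  0 < r /\
  exists (N : nat -> nat) (lambda1 lambda2 : nat -> R),
    [/\ forall n, (0 < n)%N -> has_DI_code W n (N n) (lambda1 n) (lambda2 n),
        lambda1 n @[n --> \oo] --> 0,
        lambda2 n @[n --> \oo] --> 0 &
        linearithmic_rate R N n @[n --> \oo] --> r].

(* "C is the largest achievable rate", stated as a relation because a largest
   rate need not exist for an arbitrary channel. *)
Definition is_linearithmic_DI_capacity (R : realType) (X : Type)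
    (W : X -> probability nat R) (C : R) : Prop :=
  achievable_linearithmic_rate W C /\
  forall r, achievable_linearithmic_rate W r -> r <= C.

Definition input_alphabet (R : realType) (A : R) : Type :=
  {x : R | 0 <= x <= A}.

(* The second argument of poisson_prob is a dummy. At intensity 0,
   poisson_prob is the Dirac mass at 0, in agreement with 0 ^+ 0 = 1. *)
Definition poisson_channel (R : realType) (A : R) (x : input_alphabet A) :
    probability nat R :=
  poisson_prob (sval x) 0%N.

Lemma poisson_channelE (R : realType) (A : R) (x : input_alphabet A) (y : nat) :
  poisson_channel x [set y] =
  (expR (- sval x) * sval x ^+ y / y`!%:R)%:E.
Proof.
case: x => x /= /andP[x0 xA]; rewrite /poisson_channel /= /poisson_prob.
case: ifPn => [x_gt0|]; last first.
  rewrite -leNgt => x_le0; have -> : x = 0 by apply/le_anti; rewrite x_le0 x0.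
  case: y => [|y]; rewrite diracE.
    by rewrite mem_set// oppr0 expR0 fact0 divr1 expr0 mulr1.
  by rewrite memNset// expr0n mulr0 mul0r.
rewrite esum_set1 ?lee_fin ?poisson_pmf_ge0// /poisson_pmf x_gt0.
by rewrite mulrC mulrA.
Qed.

Definition DI_error (R : realType) (A : R) (n : nat) : R :=
  expR (3 * A / 2 * (3 / 2 - log2 n%:R)).

(* Main.v *)
(* Converse: on square roots of intensities the Hellinger affinity of two
   product Poisson laws is exp(-|sqrt u - sqrt v|^2 / 2). Two codewords in a
   common cell of width 1/sqrt n have affinity above 1/2, incompatible with
   small errors, so there are at most O(sqrt n)^n codewords.

   Achievability: a family of decoders, each testing finitely many normalised
   linear statistics of y - u_j, works if for all i <> j one of the statistics
   of u_j drops in mean by n^c under u_i, the fluctuations being O(1). When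
   points lie on a sphere of radius r, the outward normal at u_j gives a drop
   |u_i - u_j|^2 / (2 r), so points at distance about sqrt r are separated,
   though a single sphere only reaches rate 1/4. Nesting spheres within spheres
   gives codewords with K digits in base b, where b^(2(K+3)) is about n: a
   Gilbert-Varshamov code at every digit makes digit vectors differ in many
   coordinates, and the pigeonhole principle puts all words on common spheres
   at every scale at polynomial cost. The rate is K/(2(K+3)) - o(1). *)
Require Import Defs.
From HB Require Import structures.
From mathcomp Require Import all_boot all_order all_algebra.
From mathcomp Require Import all_classical all_reals all_analysis.
From mathcomp Require Import ring lra zify.

Set Implicit Arguments.
Unset Strict Implicit.
Unset Printing Implicit Defensive.

Import Order.TTheory GRing.Theory Num.Theory.
Import numFieldNormedType.Exports.

Local Open Scope set_scope.
Local Open Scope nat_scope.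

(** * Nested codes over finite alphabets *)

Definition low_digits (B : nat) (w : nat -> nat) (m : nat) : nat :=
  \sum_(l < m) w l * B ^ l.

Lemma low_digitsS B w m :
  low_digits B w m.+1 = (low_digits B w m + w m * B ^ m).
Proof. exact: big_ord_recr. Qed.

Lemma low_digits_le q w m : 0 < q -> (forall l, (w l < q)) ->
  (2 * low_digits (2 * q) w m <= (2 * q) ^ m).
Proof.
move=> q0 wq; elim: m => [|m IH]; first by rewrite /low_digits big_ord0.
rewrite low_digitsS mulnDr expnS.
have := wq m; move: IH; set X := ((2 * q) ^ m) => IH wqm.
have : (w m * X + X <= q * X) by rewrite -mulSnr leq_mul2r wqm orbT.
lia.
Qed.

(** Digit [k] alone opens a gap of at least one cell [(2 * q) ^ k]; by [low_digits_le] the lower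
    digits of [w] can close at most half of it. *)
Lemma low_digits_sep q w w' k : 0 < q ->
  (forall l, (w l < q)) -> (forall l, (w' l < q)) -> (w k < w' k) ->
  ((2 * q) ^ k + 2 * low_digits (2 * q) w k.+1 <=
   2 * low_digits (2 * q) w' k.+1).
Proof.
move=> q0 wq wq' ww'; rewrite !low_digitsS !mulnDr.
have := low_digits_le k q0 wq; set X := ((2 * q) ^ k) => h.
have : (w k * X + X <= w' k * X) by rewrite -mulSnr leq_mul2r ww' orbT.
lia.
Qed.

(** A fibre of maximal size has at least the average size. The point [y0] starts the search for the
    maximum. *)
Lemma pigeonhole_fiber (T F : finType) (S : {set T}) (f : T -> F) (y0 : F) :
  exists y, (#|S| <= #|[set x in S | f x == y]| * #|F|).
Proof.
pose c y := #|[set x in S | f x == y]|.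
have [y _ ymax] := @arg_maxnP F y0 xpredT c isT.
exists y; rewrite -sum1_card (partition_big f xpredT)//= mulnC -sum_nat_const.
apply: leq_sum => z _; rewrite sum1dep_card.
by apply: (leq_trans _ (ymax z isT)); rewrite subset_leq_card//;
  apply/fintype.subsetP => x; rewrite !inE.
Qed.

Lemma card_bigcup_le (I T : finType) (P : pred I) (F : I -> {set T}) (b : nat) :
  (forall i, P i -> #|F i| <= b) -> #|\bigcup_(i | P i) F i| <= #|P| * b.
Proof.
move=> Fb; rewrite -sum_nat_const.
elim/big_rec2: _ => [|i m U Pi IH]; first by rewrite cards0.
by rewrite (leq_trans (leq_card_setU _ _))// leq_add// Fb.
Qed.

(** * Gilbert-Varshamov codes and digit words on common spheres *)

Definition hamming (n q : nat) (w w' : {ffun 'I_n -> 'I_q}) : nat :=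
  #|[set t | w t != w' t]|.

(** A word of the ball is determined by the set of coordinates where it leaves [c], at most [2 ^ n]
    choices, and by its letters there, at most [q ^ d]. A factor exponential in [n] is negligible at
    linearithmic scale. *)
Lemma card_hamming_ball (n q d : nat) (c : {ffun 'I_n -> 'I_q}) :
  0 < q -> (#|[set w | (hamming c w < d)]| <= 2 ^ n * q ^ d).
Proof.
move=> q0.
pose F (S : {set 'I_n}) t : {pred 'I_q} :=
  if t \in S then predT else pred1 (c t).
have cardF (S : {set 'I_n}) : #|S| < d -> #|family (F S)| <= q ^ d.
  move=> Sd; rewrite card_family foldrE big_map big_enum/=.
  rewrite (bigID (mem S))/= [X in (_ * X)]big1 ?muln1; last first.
    by move=> t /negbTE tS; rewrite /F tS card1.
  rewrite (eq_bigr (fun=> q)); last by move=> t tS; rewrite /F tS card_ord.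
  by rewrite prod_nat_const leq_pexp2l// ltnW.
have : [set w | (hamming c w < d)] \subset
    \bigcup_(S : {set 'I_n} | (#|S| < d)) [set w in family (F S)].
  apply/fintype.subsetP => w; rewrite inE => h; apply/finset.bigcupP.
  exists [set t | c t != w t] => //; rewrite inE; apply/familyP => t.
  by rewrite /F inE; case: eqVneq => //= ->; rewrite inE.
move=> /subset_leq_card/leq_trans; apply.
apply: (leq_trans (card_bigcup_le (b := q ^ d) _)).
  move=> S Sd; apply: (leq_trans _ (cardF _ Sd)); apply: subset_leq_card.
  by apply/fintype.subsetP => w; rewrite inE.
rewrite leq_mul2r; apply/orP; right.
apply: (leq_trans (max_card _)).
by rewrite -cardsT -powersetT card_powerset cardsT card_ord.
Qed.

(** Take a code that is maximal for inclusion: the balls around its words cover the whole space. *)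
Lemma gilbert_varshamov (n q d : nat) : 0 < q -> 0 < d ->
  exists C : {set {ffun 'I_n -> 'I_q}},
    (forall w w', w \in C -> w' \in C -> w != w' -> (d <= hamming w w')) /\
    (q ^ n <= #|C| * (2 ^ n * q ^ d)).
Proof.
move=> q0 d0.
pose P (C : {set {ffun 'I_n -> 'I_q}}) :=
  [forall w in C, forall w' in C, (w != w') ==> (d <= hamming w w')].
have [C /maxsetP[PC maxC]] : {C | maxset P C}.
  have [|C mC _] := @maxset_exists _ P finset.set0; last by exists C.
  by apply/forall_inP => w; rewrite inE.
have CP w w' : w \in C -> w' \in C -> w != w' -> (d <= hamming w w').
  move=> wC w'C; move/forall_inP: PC => /(_ w wC)/forall_inP/(_ w' w'C).
  by move/implyP.
exists C; split => //.
have hC w w' : hamming w w' = hamming w' w.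
  by rewrite /hamming; apply: eq_card => t; rewrite !inE eq_sym.
have : [set: {ffun 'I_n -> 'I_q}] \subset
    \bigcup_(c in C) [set w | hamming c w < d].
  apply/fintype.subsetP => w _; apply/finset.bigcupP.
  have [wC|wC] := boolP (w \in C).
    exists w => //; rewrite inE /hamming eq_card0// => t.
    by rewrite !inE eqxx.
  (* A word outside all the balls could be added to [C], so by maximality it already lies in [C]. *)
  apply/exists_inP; apply: contraNT wC; rewrite negb_exists_in.
  move=> /forall_inP far.
  have {}far c : c \in C -> (d <= hamming c w).
    by move=> /far; rewrite inE -leqNgt.
  rewrite -(maxC (w |: C)) ?finset.subsetUr// ?finset.setU11//.
  apply/forall_inP => x xC; apply/forall_inP => x' x'C; apply/implyP => xx'.
  move: xC x'C xx'; rewrite !inE => /predU1P[->|xC] /predU1P[->|x'C].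
  - by rewrite eqxx.
  - by rewrite hC => _; exact: far.
  - by move=> _; exact: far.
  - exact: CP.
move=> /subset_leq_card; rewrite cardsT card_ffun !card_ord.
move=> /leq_trans; apply.
by apply: card_bigcup_le => c _; exact: card_hamming_ball.
Qed.

(* Digits below [q] are read in base [2 * q]: numbers whose top digits differ
   are then far apart, as the lower digits fill at most half of a cell. *)
Definition level (n q K : nat) (W : {ffun 'I_K.+1 -> {ffun 'I_n -> 'I_q}})
    (t : 'I_n) (m : nat) : nat :=
  low_digits (2 * q) (fun l => W (inord l) t) m.

Lemma level_le (n q K : nat) (W : {ffun 'I_K.+1 -> {ffun 'I_n -> 'I_q}}) t m :
  0 < q -> level W t m <= (2 * q) ^ m.
Proof.
move=> q0.
apply: leq_trans (low_digits_le m q0 (fun l => ltn_ord (W (inord l) t))).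
by rewrite /level; lia.
Qed.

(** The index [k] is the highest digit where the words differ. Digits above it cancel, so the full
    difference is that of the truncations [level _ _ k.+1]; these lie on a common sphere, and at
    least [d] coordinates differ by half a cell or more. The sum of the two truncated subtractions
    is an absolute difference. *)
Lemma galaxy_words (n q K d : nat) : 0 < q -> 0 < d ->
  exists S : {set {ffun 'I_K.+1 -> {ffun 'I_n -> 'I_q}}},
    (q ^ n) ^ K.+1 <= #|S| * (n * (2 * q) ^ (2 * K.+1)).+1 ^ K.+1 *
                      (2 ^ n * q ^ d) ^ K.+1 /\
    forall W W', W \in S -> W' \in S -> W != W' -> exists k : 'I_K.+1,
      [/\ forall t, level W t K.+1 + level W' t k.+1 =
                    level W' t K.+1 + level W t k.+1,
          \sum_t level W t k.+1 ^ 2 = \sum_t level W' t k.+1 ^ 2 &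
          d * (2 * q) ^ (2 * k) <= 4 * \sum_t
            ((level W t k.+1 - level W' t k.+1) +
             (level W' t k.+1 - level W t k.+1)) ^ 2].
Proof.
move=> q0 d0; have [C [CP Ccard]] := gilbert_varshamov n q0 d0.
pose T : finType := {ffun 'I_K.+1 -> {ffun 'I_n -> 'I_q}}.
pose m := n * (2 * q) ^ (2 * K.+1).
pose energy (W : T) (k : nat) := \sum_t level W t k.+1 ^ 2.
have energy_lt W (k : 'I_K.+1) : energy W k < m.+1.
  rewrite ltnS /energy /m -[X in _ <= X * _]card_ord -sum_nat_const.
  apply: leq_sum => t _; rewrite (mulnC 2 K.+1) expnM leq_exp2r//.
  by rewrite (leq_trans (level_le _ _ _ q0))// leq_pexp2l ?muln_gt0.
(* A fibre of [f] fixes the energy at every scale, hence the radii of all the nested spheres at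
   once. *)
pose f (W : T) : {ffun 'I_K.+1 -> 'I_m.+1} :=
  [ffun k : 'I_K.+1 => inord (energy W k)].
pose S0 : {set T} := [set W in ffun_on (mem C)].
have [y yP] := pigeonhole_fiber S0 f [ffun=> ord0].
exists [set W in S0 | f W == y]; split.
  rewrite card_ffun !card_ord in yP.
  apply: (@leq_trans ((#|C| * (2 ^ n * q ^ d)) ^ K.+1)).
    by rewrite leq_exp2r.
  rewrite expnMn leq_mul2r; apply/orP; right; apply: leq_trans yP.
  by rewrite cardsE card_ffun_on card_ord.
move=> W W'; rewrite !inE.
move=> /andP[/ffun_onP WC /eqP fW] /andP[/ffun_onP W'C /eqP fW'] WW'.
have [k0 k0P] : exists k0, W k0 != W' k0.
  apply/existsP; apply: contraNT WW'; rewrite negb_exists => /forallP WW'.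
  by apply/eqP/ffunP => k; apply/eqP; have := WW' k; rewrite negbK.
have [k kP kmax] := @arg_maxnP _ k0 (fun k => W k != W' k) (@nat_of_ord _) k0P.
exists k; split.
- move=> t.
  suff H j : k < j <= K.+1 -> level W t j + level W' t k.+1 =
      level W' t j + level W t k.+1 by apply: H; rewrite ltn_ord/=.
  elim: j => // j IH /andP[]; rewrite ltnS leq_eqVlt => /predU1P[<- _|kj jK].
    by rewrite addnC.
  have jK' : j < K.+1 by [].
  have : W (inord j) = W' (inord j).
    apply/eqP; apply: contraTT kj => /kmax; rewrite inordK//; lia.
  rewrite /level !(low_digitsS _ _ j) => ->.
  have := IH _; rewrite kj/= ltnW// => /(_ isT); rewrite /level; lia.
- have := congr1 (fun g : {ffun _ -> _} => g k) (etrans fW (esym fW')).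
  move=> /(congr1 val).
  by rewrite !ffunE/= !inordK.
have := CP _ _ (WC k) (W'C k) kP; rewrite /hamming => dS.
rewrite (bigID (mem [set t | W k t != W' k t]))/= mulnDr.
apply: (leq_trans _ (leq_addr _ _)).
rewrite -sum1_card in dS.
apply: (@leq_trans (\sum_(t in [set t | W k t != W' k t]) (2 * q) ^ (2 * k))).
  by rewrite sum_nat_const leq_mul2r -sum1_card dS orbT.
rewrite big_distrr/=; apply: leq_sum => t; rewrite inE => Wt.
(* Writing 4 as [2 ^ 2] reduces the claim to the unsquared gap of [low_digits_sep]. *)
rewrite (mulnC 2 k) expnM (_ : 4 = 2 ^ 2)// -expnMn leq_exp2r//.
have kE : inord k = k by apply/val_inj; rewrite /= inordK.
have wl l := ltn_ord (W (inord l) t); have wl' l := ltn_ord (W' (inord l) t).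
have : W (inord k) t < W' (inord k) t \/ W' (inord k) t < W (inord k) t.
  by rewrite kE; apply/orP; rewrite -neq_ltn.
case=> lt; [have := low_digits_sep q0 wl wl' lt
           |have := low_digits_sep q0 wl' wl lt];
  rewrite -/(level W t _) -/(level W' t _); lia.
Qed.

Local Open Scope classical_set_scope.
Local Open Scope ring_scope.

(** * Product Poisson laws *)

(** The factor exp(- sum of [c i]) is left out: exponential tilts and geometric means of product
    Poisson laws are then again constants times weights. *)
Definition poisson_weight (R : realType) (n : nat) (c : 'I_n -> R)
    (y : n.-tuple nat) : R :=
  \prod_(i < n) (c i ^+ tnth y i / (tnth y i)`!%:R).

Lemma poisson_weight_ge0 (R : realType) (n : nat) (c : 'I_n -> R) y :
  (forall i, 0 <= c i) -> 0 <= poisson_weight c y.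
Proof. by move=> c0; apply: prodr_ge0 => i _; rewrite divr_ge0 ?exprn_ge0. Qed.

Lemma esum_exp_coeff (R : realType) (a c : R) : 0 <= a -> 0 <= c ->
  \esum_(k in [set: nat]) (a * (c ^+ k / k`!%:R))%:E = (a * expR c)%:E.
Proof.
move=> a0 c0.
rewrite -nneseries_esumT; last first.
  by move=> k; rewrite lee_fin mulr_ge0// divr_ge0// exprn_ge0.
under eq_eseriesr do rewrite EFinM.
rewrite nneseriesZl//; last first.
  by move=> k _; rewrite lee_fin divr_ge0// exprn_ge0.
rewrite EFinM; congr (_ * _)%E.
rewrite /expR -EFin_lim; last exact: is_cvg_series_exp_coeff.
apply/congr_lim/funext => m /=.
by rewrite -sumEFin /series/=.
Qed.

(** Induction on [n], splitting off the first coordinate; the scalar [a] is general so that it can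
    absorb the factor [expR (c ord0)]. *)
Lemma esum_poisson_weight (R : realType) (n : nat) (a : R) (c : 'I_n -> R) :
  0 <= a -> (forall i, 0 <= c i) ->
  \esum_(y in [set: n.-tuple nat]) (a * poisson_weight c y)%:E =
  (a * expR (\sum_(i < n) c i))%:E.
Proof.
elim: n a c => [|n IH] a c a0 c0.
  have -> : [set: 0.-tuple nat] = [set [tuple]].
    by apply/seteqP; split => // y _; rewrite /= [y]tuple0.
  rewrite esum_set1; last by rewrite lee_fin mulr_ge0// poisson_weight_ge0.
  by rewrite /poisson_weight !big_ord0 expR0.
pose e (zk : n.-tuple nat * nat) : n.+1.-tuple nat := [tuple of zk.2 :: zk.1].
pose b := fun i => c (lift ord0 i).
have b0 i : 0 <= b i by exact: c0.
have wE z k : a * poisson_weight c (e (z, k)) =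
    a * poisson_weight b z * (c ord0 ^+ k / k`!%:R).
  rewrite /poisson_weight big_ord_recl tnth0.
  under eq_bigr do rewrite tnthS.
  by rewrite mulrA mulrAC.
rewrite (reindex_esum ([set: n.-tuple nat] `*`` fun=> [set: nat]) _ e);
    last first.
  split => //.
    by move=> [z k] [z' k'] _ _ /(congr1 val)/= [-> /val_inj->].
  move=> y _; exists (behead_tuple y, thead y); first by [].
  by rewrite /e/= [RHS]tuple_eta.
transitivity (\esum_(z in [set: n.-tuple nat]) \esum_(k in [set: nat])
    (a * poisson_weight b z * (c ord0 ^+ k / k`!%:R))%:E).
  rewrite esum_esum.
    by apply: eq_esum => -[z k] _ /=; rewrite -wE.
  move=> z k _ _; rewrite lee_fin mulr_ge0//.
    by rewrite mulr_ge0// poisson_weight_ge0.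
  by rewrite divr_ge0// exprn_ge0.
under eq_esum => z _.
  rewrite esum_exp_coeff//; last by rewrite mulr_ge0// poisson_weight_ge0.
  rewrite mulrAC; over.
rewrite IH ?mulr_ge0 ?expR_ge0//.
by rewrite -mulrA -expRD big_ord_recl.
Qed.

Lemma le_esum_setT (R : realType) (T : choiceType) (D : set T)
    (f g : T -> \bar R) :
  (forall y, (0 <= g y)%E) -> (forall y, D y -> (f y <= g y)%E) ->
  (\esum_(y in D) f y <= \esum_(y in [set: T]) g y)%E.
Proof.
move=> g0 fg; rewrite esum_mkcond; apply: le_esum => y _.
by case: ifPn => // /[!inE]; exact: fg.
Qed.

Lemma esum_setU_le (R : realType) (T : choiceType) (I : finType)
    (D : set T) (F : I -> set T) (f : T -> \bar R) :
  (forall y, (0 <= f y)%E) -> (forall y, D y -> exists k, F k y) ->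
  (\esum_(y in D) f y <= \sum_k \esum_(y in F k) f y)%E.
Proof.
move=> f0 DF.
under eq_bigr do rewrite esum_mkcond.
rewrite -esum_sum; last by move=> y k _ _; case: ifP.
apply: le_esum_setT => y; first by apply: sume_ge0 => k _; case: ifP.
move=> /DF[k Fky]; rewrite (bigD1 k)//= mem_set// leeDl//.
by apply: sume_ge0 => l _; case: ifP.
Qed.

(** * Chernoff bounds and codes from linear tests *)

(** Squaring [expR (s / 2) * (1 - s / 2) <= 1] bounds [expR s] by a rational function, which is
    compared with [1 + s + 2 * s ^+ 2] by algebra. *)
Lemma expR_sub1_le_sqr (R : realType) (s : R) :
  `|s| <= 1 -> expR s - 1 - s <= 2 * s ^+ 2.
Proof.
rewrite ler_norml => /andP[s1 s2].
suff : expR s * (1 - s / 2) ^+ 2 <= 1.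
  move=> h.
  have h2 : 0 < (1 - s / 2) ^+ 2 by rewrite exprn_gt0//; lra.
  have : expR s <= 1 / (1 - s / 2) ^+ 2 by rewrite ler_pdivlMr.
  suff : 1 / (1 - s / 2) ^+ 2 <= 1 + s + 2 * s ^+ 2 by lra.
  rewrite ler_pdivrMr//.
  rewrite -subr_ge0.
  have -> : (1 + s + 2 * s ^+ 2) * (1 - s / 2) ^+ 2 - 1 =
    s ^+ 2 / 4 * ((1 - s) * (5 - 2 * s)) by field.
  by apply: mulr_ge0; [rewrite divr_ge0// sqr_ge0|apply: mulr_ge0; lra].
have e1 : expR (s / 2) * (1 - s / 2) <= 1.
  have := expR_ge1Dx (- (s / 2)); rewrite expRN => h.
  by rewrite -ler_pdivlMl ?expR_gt0// mulr1.
have -> : s = s / 2 + s / 2 by field.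
rewrite expRD.
have -> : s / 2 + s / 2 = s by field.
rewrite -expr2 -exprMn exprn_ile1//.
by rewrite mulr_ge0 ?expR_ge0//; lra.
Qed.

Section poisson_memoryless.
Variables (R : realType) (A : R) (n : nat).
Implicit Types (x : n.-tuple (input_alphabet A)) (y : n.-tuple nat).

Local Notation rate x := (fun i => sval (tnth x i)).

Lemma rate_ge0 x i : 0 <= rate x i.
Proof. by have /andP[] := svalP (tnth x i). Qed.

Lemma rate_le x i : rate x i <= A.
Proof. by have /andP[] := svalP (tnth x i). Qed.

Lemma memoryless_poissonE x (D : set (n.-tuple nat)) :
  memoryless (@poisson_channel R A) x D =
  \esum_(y in D) (expR (- \sum_i rate x i) * poisson_weight (rate x) y)%:E.
Proof.
apply: eq_esum => y _.
under eq_bigr do rewrite poisson_channelE.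
rewrite prodEFin; congr (_%:E).
by rewrite -sumrN expR_sum -big_split/=; apply: eq_bigr => i _; rewrite mulrA.
Qed.

Lemma poisson_point_ge0 x y :
  (0 <= (expR (- \sum_i rate x i) * poisson_weight (rate x) y)%:E)%E.
Proof.
rewrite lee_fin mulr_ge0 ?expR_ge0// poisson_weight_ge0// => i.
exact: rate_ge0.
Qed.

Lemma memoryless_poisson_setT x :
  memoryless (@poisson_channel R A) x [set: n.-tuple nat] = 1%E.
Proof.
rewrite memoryless_poissonE esum_poisson_weight ?expR_ge0//; last first.
  by move=> i; exact: rate_ge0.
by rewrite -expRD addNr expR0.
Qed.

Lemma memoryless_poisson_setC x (D : set (n.-tuple nat)) :
  (memoryless (@poisson_channel R A) x D +
   memoryless (@poisson_channel R A) x (~` D) = 1)%E.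
Proof.
rewrite -(memoryless_poisson_setT x) !memoryless_poissonE.
rewrite [RHS](esumID D); last by move=> y _; exact: poisson_point_ge0.
by rewrite !setTI.
Qed.

Lemma poisson_weight_tilt x (s : 'I_n -> R) y :
  poisson_weight (fun i => rate x i * expR (s i)) y =
  poisson_weight (rate x) y * expR (\sum_i s i * (tnth y i)%:R).
Proof.
rewrite /poisson_weight expR_sum -big_split/=; apply: eq_bigr => i _.
by rewrite exprMn -expRM_natr mulrAC.
Qed.

(** Exponential Markov inequality: on [D] the law is dominated by a tilted weight of explicit total
    mass. Each coordinate adds [x_i * (expR s_i - 1 - s_i)] to the exponent, at most
    [2 * A * s_i ^+ 2]. *)
Lemma poisson_chernoff x (s : 'I_n -> R) (tau : R) (D : set (n.-tuple nat)) :
  (forall i, `|s i| <= 1) ->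
  (forall y, D y -> tau <= \sum_i s i * ((tnth y i)%:R - rate x i)) ->
  (memoryless (@poisson_channel R A) x D <=
   (expR (2 * A * \sum_i s i ^+ 2 - tau))%:E)%E.
Proof.
move=> s1 Dtau; rewrite memoryless_poissonE.
pose a := expR (- \sum_i rate x i - \sum_i s i * rate x i - tau).
have xs0 i : 0 <= rate x i * expR (s i) by rewrite mulr_ge0 ?expR_ge0 ?rate_ge0.
apply: (@le_trans _ _ (\esum_(y in [set: n.-tuple nat])
   (a * poisson_weight (fun i => rate x i * expR (s i)) y)%:E)).
  apply: le_esum_setT => y.
    by rewrite lee_fin mulr_ge0 ?expR_ge0 ?poisson_weight_ge0.
  move=> /Dtau; rewrite lee_fin poisson_weight_tilt.
  have -> : \sum_i s i * ((tnth y i)%:R - rate x i) =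
    \sum_i s i * (tnth y i)%:R - \sum_i s i * rate x i.
    by rewrite -sumrB; apply: eq_bigr => i _; rewrite mulrBr.
  move=> h; rewrite [leRHS]mulrCA [leRHS]mulrC; apply: ler_wpM2r.
    by apply: poisson_weight_ge0 => i; exact: rate_ge0.
  by rewrite -expRD ler_expR; lra.
rewrite esum_poisson_weight ?expR_ge0// -expRD lee_fin ler_expR.
suff : \sum_i rate x i * expR (s i) - \sum_i rate x i - \sum_i s i * rate x i
   <= 2 * A * \sum_i s i ^+ 2 by lra.
rewrite -!sumrB mulr_sumr; apply: ler_sum => i _.
have x0 := rate_ge0 x i; have xA := rate_le x i.
have e := expR_sub1_le_sqr (s1 i).
apply: (@le_trans _ _ (rate x i * (2 * s i ^+ 2))).
  have := ler_wpM2l x0 e; lra.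
rewrite mulrCA mulrA; apply: ler_wpM2r; first exact: sqr_ge0.
by rewrite mulrC; lra.
Qed.

End poisson_memoryless.

(* The decoding set of [j] is cut out by the half-spaces
   [\sum_t a j k t * (y_t - u_j,t) >= - tau]. *)
Lemma linear_test_code (R : realType) (A : R) (n N K : nat)
    (u : 'I_N -> n.-tuple (input_alphabet A)) (a : 'I_N -> 'I_K -> 'I_n -> R)
    (tau : R) :
  (0 < n)%N ->
  (forall j k t, 0 <= a j k t <= 1) ->
  (forall i j, i != j -> exists k, \sum_t a j k t *
     (sval (tnth (u i) t) - sval (tnth (u j) t)) <= - (2 * tau)) ->
  has_DI_code (@poisson_channel R A) n N
    (K%:R * expR (2 * A - tau / Num.sqrt n%:R))
    (expR (2 * A - tau / Num.sqrt n%:R)).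
Proof.
move=> n0 a01 usep.
have sn0 : 0 < Num.sqrt n%:R :> R by rewrite sqrtr_gt0 ltr0n.
have sn2 : Num.sqrt n%:R ^+ 2 = n%:R :> R by rewrite sqr_sqrtr.
have sn1 : 1 <= Num.sqrt n%:R :> R.
  by rewrite -[X in X <= _]sqrtr1 ler_wsqrtr// ler1n.
pose test j k (y : n.-tuple nat) :=
  \sum_t a j k t * ((tnth y t)%:R - sval (tnth (u j) t)).
(* Tilts of size at most [1 / sqrt n] have squares summing to at most 1, which leaves [2 * A] in the
   exponent. The sign [sg] is -1 for the first kind of error (lower tail) and 1 for the second
   (upper tail). *)
have chernoff i j k (sg : R) (D : set (n.-tuple nat)) : `|sg| = 1 ->
    (forall y, D y ->
      tau <= \sum_t sg * a j k t * ((tnth y t)%:R - sval (tnth (u i) t))) ->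
    (memoryless (@poisson_channel R A) (u i) D <=
     (expR (2 * A - tau / Num.sqrt n%:R))%:E)%E.
  move=> sg1 DP.
  have A0 : 0 <= A.
    exact: (le_trans (rate_ge0 (u i) (Ordinal n0)) (rate_le _ _)).
  have s2 t : (sg * a j k t / Num.sqrt n%:R) ^+ 2 <= n%:R^-1.
    have /andP[a0 a1] := a01 j k t.
    rewrite expr_div_n sn2 exprMn -[sg ^+ 2]ger0_norm ?sqr_ge0// normrX sg1.
    rewrite expr1n mul1r ler_pdivrMr ?ltr0n// mulVf ?pnatr_eq0 ?gtn_eqF//.
    by rewrite expr_le1.
  apply: (@le_trans _ _ (expR (2 * A *
    \sum_t (sg * a j k t / Num.sqrt n%:R) ^+ 2 - tau / Num.sqrt n%:R))%:E).
    apply: poisson_chernoff => [t|y /DP h].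
      rewrite -(@ler_pXn2r _ 2)// ?nnegrE// -normrX ger0_norm ?sqr_ge0//.
      by rewrite (le_trans (s2 t))// expr1n invf_le1 ?ltr0n// ler1n.
    rewrite ler_pdivrMr// mulr_suml (le_trans h)//.
    by apply: ler_sum => t _; rewrite [_ / _ * _]mulrAC divfK ?gt_eqF.
  rewrite lee_fin ler_expR lerD2r ler_piMr ?mulr_ge0//.
  apply: (le_trans (ler_sum _ (fun t _ => s2 t))).
  by rewrite sumr_const card_ord -[_ *+ n]mulr_natr mulVf// pnatr_eq0 gtn_eqF.
pose D j := [set y | forall k, - tau <= test j k y].
exists u, D => i j ij; split.
  have := memoryless_poisson_setC (u i) (D i).
  suff : (memoryless (@poisson_channel R A) (u i) (~` D i) <=
     (K%:R * expR (2 * A - tau / Num.sqrt n%:R))%:E)%E.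
    move=> h mC; rewrite EFinB -[1%:E]mC leeBlDr//.
    by rewrite leeD2l.
  rewrite memoryless_poissonE.
  pose F k := [set y | test i k y < - tau].
  apply: (@le_trans _ _
    (\sum_k memoryless (@poisson_channel R A) (u i) (F k))%E).
    rewrite (eq_bigr _ (fun k _ => memoryless_poissonE (u i) (F k))).
    apply: esum_setU_le => y; first exact: poisson_point_ge0.
    move=> /existsNP[k /negP]; rewrite -ltNge => h.
    by exists k.
  have -> : (K%:R * expR (2 * A - tau / Num.sqrt n%:R))%:E =
    (\sum_(k < K) (expR (2 * A - tau / Num.sqrt n%:R))%:E)%E.
    by rewrite sumEFin sumr_const card_ord mulr_natl.
  apply: lee_sum => k _; apply: (chernoff i i k (-1)); first by rewrite normrN1.
  move=> y /ltW; rewrite /test lerNr => h; apply: (le_trans h).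
  by rewrite -sumrN; apply: ler_sum => t _; rewrite mulN1r mulNr.
have [k hk] := usep _ _ ij.
apply: (chernoff i j k 1); first by rewrite normr1.
move=> y /(_ k); rewrite /test => h.
(* Under [u i] the mean of test [k] sits at least [2 * tau] too low, so reaching [- tau] is an
   upward deviation of at least [tau]. *)
have -> : \sum_t 1 * a j k t * ((tnth y t)%:R - sval (tnth (u i) t)) =
  \sum_t a j k t * ((tnth y t)%:R - sval (tnth (u j) t)) -
  \sum_t a j k t * (sval (tnth (u i) t) - sval (tnth (u j) t)).
  by rewrite -sumrB; apply: eq_bigr => t _; ring.
lra.
Qed.

(** * Converse *)

Lemma esumZl_le (R : realType) (T : choiceType) (D : set T) (c : R)
    (f : T -> \bar R) :
  0 <= c -> (forall y, (0 <= f y)%E) ->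
  (\esum_(y in D) (c%:E * f y) <= c%:E * \esum_(y in D) f y)%E.
Proof.
move=> c0 f0; apply: ge_ereal_sup => _ [X XD <-].
rewrite -ge0_mule_fsumr//; apply: lee_wpmul2l; first by rewrite lee_fin.
by apply: esum_ge; exists X.
Qed.

Lemma amgm_weighted (R : realType) (r p q t : R) :
  0 <= p -> 0 <= q -> 0 < t -> r ^+ 2 = p * q -> 2 * r <= t * p + q / t.
Proof.
move=> p0 q0 t0 rpq.
have s0 : 0 <= t * p + q / t.
  by rewrite addr_ge0 ?[0 <= q / t]divr_ge0 ?mulr_ge0 ?(ltW t0).
have [r0|r0] := leP r 0; first by apply: le_trans s0; lra.
rewrite -(@ler_pXn2r _ 2)// ?nnegrE//; last lra.
rewrite exprMn rpq -subr_ge0.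
have -> : (t * p + q / t) ^+ 2 - 2 ^+ 2 * (p * q) = (t * p - q / t) ^+ 2.
  by field; rewrite gt_eqF.
exact: sqr_ge0.
Qed.

(** The left side is the Hellinger affinity, the total mass of the geometric mean [r] of the two
    laws. It is split over [D] and its complement, each law being small on one of the two. *)
Lemma poisson_affinity_le (R : realType) (A : R) (n : nat)
    (u v : n.-tuple (input_alphabet A)) (D : set (n.-tuple nat)) (l1 l2 : R) :
  ((1 - l1)%:E <= memoryless (@poisson_channel R A) u D)%E ->
  (memoryless (@poisson_channel R A) v D <= l2%:E)%E ->
  expR (- (\sum_i (Num.sqrt (sval (tnth u i)) -
                   Num.sqrt (sval (tnth v i))) ^+ 2 / 2)) <=
  1 / 4 + 2 * (l1 + l2).
Proof.
move=> uD vD.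
pose c i := Num.sqrt (sval (tnth u i)) * Num.sqrt (sval (tnth v i)).
have c0 i : 0 <= c i by rewrite mulr_ge0// sqrtr_ge0.
pose p (x : n.-tuple (input_alphabet A)) y :=
  expR (- \sum_i sval (tnth x i)) *
  poisson_weight (fun i => sval (tnth x i)) y.
have p0 x y : 0 <= p x y.
  by rewrite -lee_fin; exact: poisson_point_ge0.
pose a := expR (- (\sum_i (sval (tnth u i) + sval (tnth v i)) / 2)).
pose r y := a * poisson_weight c y.
have r0 y : 0 <= r y by rewrite mulr_ge0 ?expR_ge0 ?poisson_weight_ge0.
have rpq y : r y ^+ 2 = p u y * p v y.
  rewrite /r /p mulrACA exprMn; congr (_ * _).
    rewrite /a -expRD -expRM_natr; congr expR.
    rewrite -opprD -big_split/= mulNr mulr_suml; congr (- _).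
    by apply: eq_bigr => i _; rewrite mulrVK// unitfE.
  rewrite /poisson_weight -big_split/= -prodrXl; apply: eq_bigr => i _.
  rewrite expr_div_n mulf_div -[in RHS]expr2; congr (_ / _).
  rewrite -exprMn -!exprM mulnC exprM -[c i ^+ 2]/(c i * c i) mulrACA -!expr2.
  by rewrite !sqr_sqrtr ?rate_ge0.
have affE : \esum_(y in [set: n.-tuple nat]) (r y)%:E =
    (expR (- (\sum_i (Num.sqrt (sval (tnth u i)) -
                   Num.sqrt (sval (tnth v i))) ^+ 2 / 2)))%:E.
  rewrite esum_poisson_weight ?expR_ge0// -expRD; congr ((expR _)%:E).
  rewrite -!sumrN -big_split/=; apply: eq_bigr => i _.
  by rewrite sqrrB !sqr_sqrtr ?rate_ge0// /c; field.
have mE x (E : set _) : memoryless (@poisson_channel R A) x E =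
    \esum_(y in E) (p x y)%:E by exact: memoryless_poissonE.
have mC x : (\esum_(y in D) (p x y)%:E + \esum_(y in ~` D) (p x y)%:E = 1)%E.
  by rewrite -!mE memoryless_poisson_setC.
have part (E : set (n.-tuple nat)) (t : R) : 0 < t ->
  (\esum_(y in E) (r y)%:E <= ((t / 2)%:E * \esum_(y in E) (p u y)%:E) +
     ((t^-1 / 2)%:E * \esum_(y in E) (p v y)%:E))%E.
  move=> t0.
  have t20 : 0 <= t / 2 by rewrite divr_ge0// ltW.
  have tv20 : 0 <= t^-1 / 2 by rewrite divr_ge0// invr_ge0 ltW.
  apply: (@le_trans _ _ (\esum_(y in E) ((t / 2)%:E * (p u y)%:E +
     (t^-1 / 2)%:E * (p v y)%:E)%E)).
    apply: le_esum => y _; rewrite -!EFinM -EFinD lee_fin.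
    have := amgm_weighted (p0 u y) (p0 v y) t0 (rpq y).
    have -> : t / 2 * p u y + t^-1 / 2 * p v y =
      (t * p u y + p v y / t) / 2 by field; rewrite gt_eqF.
    lra.
  rewrite esumD.
  - by apply: leeD; apply: esumZl_le => // y; rewrite lee_fin.
  - by move=> y _; apply: mule_ge0; rewrite lee_fin.
  - by move=> y _; apply: mule_ge0; rewrite lee_fin.
suff : (\esum_(y in [set: n.-tuple nat]) (r y)%:E <=
  (1 / 4 + 2 * (l1 + l2))%:E)%E by rewrite affE lee_fin.
rewrite (esumID D); last by move=> y _; rewrite lee_fin.
rewrite !setTI.
have := mC u; have := mC v; move: uD vD; rewrite !mE.
(* The weights favour the small law on each piece: the large masses contribute 1/8 each, the error
   masses enter with factor 2. *)
have := part D (1 / 4); have := part (~` D) 4.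
have E0 x E : (0 <= \esum_(y in E) (p x y)%:E)%E.
  by apply: esum_ge0 => y _; rewrite lee_fin.
move: (E0 u D) (E0 v D) (E0 u (~` D)) (E0 v (~` D)).
case: (\esum_(y in D) (p u y)%:E) => [a1| |] //;
case: (\esum_(y in ~` D) (p u y)%:E) => [a2| |] //;
case: (\esum_(y in D) (p v y)%:E) => [a3| |] //;
case: (\esum_(y in ~` D) (p v y)%:E) => [a4| |] //.
rewrite -!EFinM -!EFinD !lee_fin.
move=> a10 a30 a20 a40 h1 h2 h3 h4 [h5] [h6].
apply: (le_trans (leeD (h2 _) (h1 _))); rewrite ?lee_fin; lra.
Qed.

(** Number of cells of width [1 / sqrt n] that cover [[0, sqrt A]], the range of the square roots of
    intensities. *)
Definition DI_size_base (R : realType) (A : R) (n : nat) : nat :=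
  (Num.truncn (Num.sqrt (A * n%:R))).+1.

(** Rounding the square roots to cells is injective on codewords: a common cell vector forces
    affinity at least exp(-1/2) > 1/2, while errors of sum at most 1/8 allow only 1/4 + 2/8. *)
Lemma DI_code_size_le (R : realType) (A : R) (n N : nat) (l1 l2 : R) :
  (0 < n)%N -> l1 + l2 <= 1 / 8 ->
  has_DI_code (@poisson_channel R A) n N l1 l2 ->
  (N <= DI_size_base A n ^ n)%N.
Proof.
move=> n0 l12 [u [D codeP]].
pose v i t := Num.sqrt (sval (tnth (u i) t)) * Num.sqrt n%:R.
have v0 i t : 0 <= v i t by rewrite mulr_ge0 ?sqrtr_ge0.
pose f i : {ffun 'I_n -> 'I_(DI_size_base A n)} :=
  [ffun t => inord (Num.truncn (v i t))].
suff /leq_card : injective f by rewrite card_ffun !card_ord.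
move=> i j fij; apply/eqP/negPn/negP => ij.
have [uD _] := codeP _ _ ij.
have ji : j != i by rewrite eq_sym.
have [_ vD] := codeP _ _ ji.
have := poisson_affinity_le uD vD.
apply/negP; rewrite -ltNge.
apply: (@le_lt_trans _ _ (1 + - (1 / 2))); first by lra.
apply: (@lt_le_trans _ _ (expR (- (1 / 2)))); first by apply: expR_gt1Dx; lra.
rewrite ler_expR lerN2 -mulr_suml ler_pM2r//.
have sn0 : 0 < Num.sqrt n%:R :> R by rewrite sqrtr_gt0 ltr0n.
suff le1 t : (Num.sqrt (sval (tnth (u i) t)) -
    Num.sqrt (sval (tnth (u j) t))) ^+ 2 <= n%:R^-1.
  apply: (le_trans (ler_sum _ (fun t _ => le1 t))).
  by rewrite sumr_const card_ord -[_ *+ n]mulr_natr mulVf// pnatr_eq0 gtn_eqF.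
rewrite -[_^-1]mul1r ler_pdivlMr ?ltr0n//.
rewrite -[X in _ * X](@sqr_sqrtr _ n%:R)// -exprMn mulrBl.
have truncE : Num.truncn (v i t) = Num.truncn (v j t).
  have tQ h : (Num.truncn (v h t) < DI_size_base A n)%N.
    rewrite ltnS le_truncn// /v -sqrtrM ?rate_ge0// ler_wsqrtr//.
    by rewrite ler_wpM2r// rate_le.
  have /(congr1 val) := congr1 (fun g : {ffun _ -> _} => g t) fij.
  by rewrite !ffunE/= !inordK.
have /andP[i1 i2] := truncn_itv (v0 i t).
have /andP[j1 j2] := truncn_itv (v0 j t).
rewrite truncE in i1 i2; rewrite -/(v i t) -/(v j t).
rewrite -[leRHS](expr1n _ 2) -ler_sqrt ?sqr_ge0 ?exprn_ge0//.
rewrite !sqrtr_sqr normr1 ler_norml.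
rewrite -natr1 in i2 j2.
apply/andP; split; lra.
Qed.

(** * Achievability *)

(** The right side is [A / 8 * d * b ^ k / b ^ (K + 2)], least at [k = 0]. From [b * d >= 2 * n] and
    [b ^ (K + 4) <= sqrt n] comes [d >= 2 * sqrt n * b ^ (K + 3)], exactly enough. There are [K.+1]
    digits, so [K.+4] is their number plus three. *)
Lemma galaxy_code_gap (R : realType) (n q K k d : nat) (A b : R) :
  b = (2 * q)%:R ->
  0 <= A -> (0 < q)%N -> ((2 * q) ^ (2 * K.+4) <= n)%N -> (n <= q * d)%N ->
  2 * (A * Num.sqrt n%:R * b / 8) <=
    A / b ^+ K.+1 / b ^+ k.+1 * (d%:R * b ^+ (2 * k) / 8).
Proof.
move=> bE A0 q0 bn nqd.
have b1 : 1 <= b by rewrite bE ler1n muln_gt0.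
have b0 : 0 < b by lra.
pose s : R := Num.sqrt n%:R.
have s2 : s ^+ 2 = n%:R by rewrite sqr_sqrtr.
have s0 : 0 <= s by exact: sqrtr_ge0.
have bs : b ^+ K.+4 <= s.
  rewrite -(@ler_pXn2r _ 2) ?nnegrE ?exprn_ge0 ?(ltW b0)// s2 -exprM mulnC.
  by rewrite bE -natrX ler_nat.
have bk0 j : 0 < b ^+ j by rewrite exprn_gt0.
have db : 2 * s * b ^+ K.+3 <= d%:R.
  rewrite -(ler_pM2r b0).
  have -> : 2 * s * b ^+ K.+3 * b = 2 * s * b ^+ K.+4.
    by rewrite [in RHS]exprSr !mulrA.
  apply: (@le_trans _ _ (2 * s * s)); first by rewrite ler_wpM2l ?mulr_ge0.
  rewrite -mulrA -expr2 s2 bE -!natrM ler_nat.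
  by rewrite mulnCA leq_mul2l mulnC.
rewrite -/s.
have -> : A / b ^+ K.+1 / b ^+ k.+1 * (d%:R * b ^+ (2 * k) / 8) =
    A / 8 * (d%:R * b ^+ k / b ^+ K.+2).
  rewrite mul2n -addnn exprD !exprS; field.
  by rewrite !gt_eqF.
have -> : 2 * (A * s * b / 8) = A / 8 * (2 * s * b) by field.
rewrite ler_wpM2l ?divr_ge0// ler_pdivlMr//.
have -> : 2 * s * b * b ^+ K.+2 = 2 * s * b ^+ K.+3.
  by rewrite [in RHS]exprS !mulrA.
apply: (le_trans db); rewrite ler_peMr//.
exact: exprn_ege1.
Qed.

(* All words have equal energies [\sum_t level W t m ^ 2], so testing along
   [level V] shifts the mean by minus half the squared distance from [V]. *)
Lemma galaxy_code (R : realType) (A : R) (n q K : nat) :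
  0 <= A -> (0 < n)%N -> (0 < q)%N -> ((2 * q) ^ (2 * K.+4) <= n)%N ->
  exists N : nat,
    has_DI_code (@poisson_channel R A) n N
      (K.+1%:R * expR (2 * A - A * q%:R / 4)) (expR (2 * A - A * q%:R / 4)) /\
    ((q ^ n) ^ K.+1 <=
       N * (n ^ 2).+1 ^ K.+1 * (2 ^ n * q ^ (n %/ q).+1) ^ K.+1)%N.
Proof.
move=> A0 n0 q0 bn.
have [S [Scard Ssep]] := galaxy_words n K q0 (ltn0Sn (n %/ q)).
exists #|S|; split; last first.
  apply: leq_trans Scard _; rewrite leq_mul2r leq_mul2l leq_exp2r// ltnS.
  rewrite -mulnn leq_mul2l; apply/orP; right; apply/orP; right.
  apply/orP; right; apply: leq_trans bn; rewrite leq_pexp2l ?muln_gt0//; lia.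
pose b : R := (2 * q)%:R.
have b1 : 1 <= b by rewrite ler1n muln_gt0.
have b0 : 0 < b by lra.
have bk0 j : 0 < b ^+ j by rewrite exprn_gt0.
have lev01 (W : {ffun 'I_K.+1 -> {ffun 'I_n -> 'I_q}}) t m :
    0 <= (level W t m)%:R / b ^+ m <= 1.
  rewrite divr_ge0 ?(ltW (bk0 _))//= ler_pdivrMr// mul1r -natrX ler_nat.
  exact: level_le.
have uP (W : {ffun 'I_K.+1 -> {ffun 'I_n -> 'I_q}}) t :
    0 <= A * ((level W t K.+1)%:R / b ^+ K.+1) <= A.
  have /andP[l0 l1] := lev01 W t K.+1.
  by rewrite mulr_ge0//= ler_piMr.
pose u (i : 'I_#|S|) : n.-tuple (input_alphabet A) :=
  [tuple exist (fun x : R => 0 <= x <= A) _ (uP (enum_val i) t) | t < n].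
have uE i t : sval (tnth (u i) t) =
    A * ((level (enum_val i) t K.+1)%:R / b ^+ K.+1).
  by rewrite tnth_mktuple.
(* Half of the drop guaranteed by [galaxy_code_gap]; the extra factor [b] over [sqrt n] makes the
   error exponent grow linearly in [q]. *)
pose tau := A * Num.sqrt n%:R * b / 8.
have -> : A * q%:R / 4 = tau / Num.sqrt n%:R.
  rewrite /tau /b natrM; field.
  by rewrite gt_eqF// sqrtr_gt0 ltr0n.
apply: (linear_test_code (u := u)
  (a := fun j (k : 'I_K.+1) t =>
     (level (enum_val j) t k.+1)%:R / b ^+ k.+1)) => //.
move=> i j ij; set W := enum_val i; set V := enum_val j.
have WV : W != V by apply: contraNneq ij => /enum_val_inj ->.
have [k [full energy dist]] := Ssep W V (enum_valP i) (enum_valP j) WV.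
exists k.
have nqd : (n <= q * (n %/ q).+1)%N by rewrite mulnC ltnW// ltn_ceil.
have gap := galaxy_code_gap k erefl A0 q0 bn nqd.
apply: (@le_trans _ _ (- (A / b ^+ K.+1 / b ^+ k.+1 *
    ((n %/ q).+1%:R * b ^+ (2 * k) / 8)))); last by rewrite lerN2.
have -> : \sum_t (level V t k.+1)%:R / b ^+ k.+1 *
      (sval (tnth (u i) t) - sval (tnth (u j) t)) =
    A / b ^+ K.+1 / b ^+ k.+1 * \sum_t ((level V t k.+1)%:R *
      ((level W t k.+1)%:R - (level V t k.+1)%:R)).
  rewrite mulr_sumr; apply: eq_bigr => t _; rewrite !uE -/W -/V.
  (* The intensities carry all the digits, but their difference involves only those up to [k]. *)
  have /(congr1 (fun m => m%:R : R)) := full t; rewrite !natrD => h.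
  have -> : (level W t k.+1)%:R - (level V t k.+1)%:R =
    (level W t K.+1)%:R - (level V t K.+1)%:R :> R by lra.
  by field; rewrite !gt_eqF.
rewrite -mulrN; apply: ler_wpM2l; first by rewrite !divr_ge0// ltW.
have sumE : \sum_t ((level V t k.+1)%:R *
      ((level W t k.+1)%:R - (level V t k.+1)%:R)) =
    - (\sum_t ((level W t k.+1)%:R - (level V t k.+1)%:R) ^+ 2) / 2 :> R.
  have /(congr1 (fun m => m%:R : R)) := energy; rewrite !natr_sum => h.
  have h0 :
      \sum_t ((level W t k.+1)%:R ^+ 2 - (level V t k.+1)%:R ^+ 2) = 0 :> R.
    apply/eqP; rewrite sumrB subr_eq0 -(eq_bigr _ (fun t _ => natrX R _ 2)) h.
    by apply/eqP/eq_bigr => t _; rewrite natrX.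
  have e t : (level V t k.+1)%:R * ((level W t k.+1)%:R - (level V t k.+1)%:R) =
      - ((level W t k.+1)%:R - (level V t k.+1)%:R) ^+ 2 / 2 +
      ((level W t k.+1)%:R ^+ 2 - (level V t k.+1)%:R ^+ 2) / 2 :> R by field.
  rewrite (eq_bigr _ (fun t _ => e t)) big_split/= -!mulr_suml h0 mul0r addr0.
  by rewrite sumrN.
rewrite sumE mulNr lerN2.
have : (((n %/ q).+1 * (2 * q) ^ (2 * k))%:R : R) <=
   4 * \sum_t ((level W t k.+1)%:R - (level V t k.+1)%:R) ^+ 2.
  move: dist; rewrite -(ler_nat R) => /le_trans; apply.
  rewrite natrM natr_sum ler_wpM2l//; apply: ler_sum => t _; rewrite natrX.
  have [le|le] := leqP (level W t k.+1) (level V t k.+1).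
    by rewrite (eqP le) add0n natrB// -sqrrN opprB.
  by rewrite (eqP (ltnW le)) addn0 natrB// ltnW.
rewrite natrM natrX -/b; lra.
Qed.

(** * Asymptotics *)

Lemma linearithmic_rateE (R : realType) (N : nat -> nat) (n : nat) :
  linearithmic_rate R N n = ln (N n)%:R / (n%:R * ln n%:R) :> R.
Proof.
have l2 : ln 2 != 0 :> R by rewrite gt_eqF// ln_gt0// ltr1n.
by rewrite /linearithmic_rate /log2 [n%:R * _]mulrA invf_div mulrA divfK.
Qed.

Lemma near_ln_ge (R : realType) (c : R) : \forall n \near \oo, c <= ln n%:R.
Proof.
near=> n.
have h : expR c <= n%:R by near: n; exact: nbhs_infty_ger.
by rewrite -ler_expR lnK// posrE (lt_le_trans (expR_gt0 _) h).
Unshelve. all: by end_near. Qed.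

Lemma near_DI_error_le (R : realType) (A e : R) : 0 < A -> 0 < e ->
  \forall n \near \oo, DI_error A n <= e.
Proof.
move=> A0 e0; have l2 : 0 < ln 2 :> R by rewrite ln_gt0// ltr1n.
near=> n.
rewrite /DI_error -(lnK e0) ler_expR /log2.
have : (3 / 2 - ln e / (3 * A / 2)) * ln 2 <= ln n%:R.
  by near: n; exact: near_ln_ge.
rewrite -ler_pdivlMr// lerBlDr -lerBlDl => h.
by rewrite mulrC -ler_pdivlMr ?divr_gt0 ?mulr_gt0.
Unshelve. all: by end_near. Qed.

(** The number of cells is at most [(sqrt A + 1) * sqrt n], whose logarithm is half of [ln n] up to
    a constant. The threshold on [n] is uniform in the code. *)
Lemma near_rate_le (R : realType) (A e : R) : 0 < A -> 0 < e ->
  \forall n \near \oo, forall (N : nat) (l1 l2 : R), l1 + l2 <= 1 / 8 ->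
    has_DI_code (@poisson_channel R A) n N l1 l2 ->
    ln N%:R / (n%:R * ln n%:R) <= 1 / 2 + e :> R.
Proof.
move=> A0 e0; near=> n => N l1 l2 l12 code.
have n0 : (0 < n)%N by near: n; exact: nbhs_infty_gt.
have nR : 0 < n%:R :> R by rewrite ltr0n.
have lnn : 0 < ln n%:R :> R.
  by apply: (@lt_le_trans _ _ 1) => //; near: n; exact: near_ln_ge.
have lnC : ln (Num.sqrt A + 1) / e <= ln n%:R by near: n; exact: near_ln_ge.
have NQ := DI_code_size_le n0 l12 code.
set Q := DI_size_base A n in NQ.
have Q0 : (0 < Q)%N by [].
have s1 : 1 <= Num.sqrt n%:R :> R.
  by rewrite -[X in X <= _]sqrtr1 ler_wsqrtr// ler1n.
have lnQ : ln Q%:R <= ln (Num.sqrt A + 1) + ln n%:R / 2.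
  have sA : 0 < Num.sqrt A + 1 by rewrite ltr_wpDl// sqrtr_ge0.
  have -> : ln n%:R / 2 = ln (Num.sqrt n%:R) :> R.
    have sn0 : 0 < Num.sqrt n%:R :> R by rewrite sqrtr_gt0.
    have := lnXn 2 sn0; rewrite sqr_sqrtr// => ->.
    by rewrite -[_ *+ 2]mulr_natr mulfK.
  rewrite -lnM ?posrE ?sqrtr_gt0// ler_ln ?posrE ?ltr0n ?mulr_gt0 ?sqrtr_gt0//.
  rewrite /Q /DI_size_base -natr1 mulrDl mul1r lerD// -sqrtrM ?(ltW A0)//.
  by rewrite truncn_le sqrtr_ge0.
have lnN : ln N%:R <= n%:R * ln Q%:R :> R.
  (* An empty code is covered by the convention [ln 0 = 0]. *)
  have [->|N0] := posnP N.
    by rewrite ln0// mulr_ge0// ln_ge0// ler1n.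
  rewrite mulr_natl -lnXn ?ltr0n// ler_ln ?posrE ?exprn_gt0 ?ltr0n//.
  by rewrite -natrX ler_nat.
rewrite ler_pdivrMr ?mulr_gt0// (le_trans lnN)// mulrCA ler_pM2l//.
apply: (le_trans lnQ); rewrite mulrDl addrC lerD//; first lra.
by rewrite mulrC -ler_pdivrMr.
Unshelve. all: by end_near. Qed.

Lemma has_DI_code_le (R : realType) (X : Type) (W : X -> probability nat R)
    (n N : nat) (l1 l2 m1 m2 : R) : l1 <= m1 -> l2 <= m2 ->
  has_DI_code W n N l1 l2 -> has_DI_code W n N m1 m2.
Proof.
move=> lm1 lm2 [u [D codeP]]; exists u, D => i j /codeP[uD vD]; split.
  by apply: le_trans uD; rewrite lee_fin lerB.
by apply: (le_trans vD); rewrite lee_fin.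
Qed.

(** Supplies the base [2 * q] of the digits, about the [M]-th root of [n]; for small [n] the value
    of [q] may be 0. *)
Lemma even_root (M n : nat) : (0 < M)%N ->
  exists q, ((2 * q) ^ M <= n < (2 * q.+1) ^ M)%N.
Proof.
move=> M0.
have ex : exists q, ((2 * q) ^ M <= n)%N by exists 0%N; rewrite muln0 exp0n.
have bound q : ((2 * q) ^ M <= n)%N -> (q <= n)%N.
  apply: leq_trans; rewrite -[X in (X <= _)%N]expn1.
  case: q => // q; apply: (@leq_trans ((2 * q.+1) ^ 1)).
    by rewrite leq_exp2r//; lia.
  by rewrite leq_pexp2l//; lia.
case: (ex_maxnP ex bound) => q qn qmax; exists q; rewrite qn/= ltnNge.
by apply/negP => /qmax; rewrite ltnn.
Qed.

Lemma near_root_ge (M q0 : nat) :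
  \forall n \near \oo, forall q, (n < (2 * q.+1) ^ M)%N -> (q0 <= q)%N.
Proof.
near=> n => q nq; rewrite leqNgt; apply/negP => qq0.
have : ((2 * q0) ^ M <= n)%N by near: n; exact: nbhs_infty_ge.
rewrite leqNgt => /negP; apply; apply: (leq_trans nq).
have [M0|M0] := posnP M; first by rewrite M0.
by rewrite leq_exp2r// leq_mul2l.
Unshelve. all: by end_near. Qed.

(** Since [q.+1 <= 2 * q], the number [n] is at most [(4 * q) ^ M]. *)
Lemma ln_root_le (R : realType) (M n q : nat) : (0 < n)%N -> (0 < q)%N ->
  (n < (2 * q.+1) ^ M)%N -> ln n%:R <= M%:R * (ln 4 + ln q%:R) :> R.
Proof.
move=> n0 q0 nq; have qR : 0 < q%:R :> R by rewrite ltr0n.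
rewrite -lnM ?posrE// mulr_natl -lnXn ?mulr_gt0//.
rewrite ler_ln ?posrE ?exprn_gt0 ?mulr_gt0 ?ltr0n//.
rewrite -natrM -natrX ler_nat; apply: (leq_trans (ltnW nq)).
by case: M {nq} => [|M]; rewrite ?expn0// leq_exp2r//; lia.
Qed.

(** The code errors decay exponentially in [q], hence in a power of [n], whereas [DI_error] decays
    only like a power of [n]. *)
Lemma code_error_le (R : realType) (A : R) (K M : nat) : 0 < A ->
  exists q0 : nat, forall q n, (q0 <= q)%N -> (0 < q)%N -> (0 < n)%N ->
    (n < (2 * q.+1) ^ M)%N ->
    K%:R * expR (2 * A - A * q%:R / 4) <= DI_error A n.
Proof.
move=> A0; have l2 : 0 < ln 2 :> R by rewrite ln_gt0// ltr1n.
(* The successor keeps [G] positive when [M = 0]. *)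
pose G : R := 3 * A / 2 * M.+1%:R / ln 2.
have G0 : 0 < G by rewrite divr_gt0// !mulr_gt0// ltr0n.
(* Chosen so that [G * (q / s)] is [A * q / 8], half of the available exponent; the other half
   absorbs the constant [c]. *)
pose s := 8 * G / A.
have s0 : 0 < s by rewrite divr_gt0// mulr_gt0.
pose c := K%:R + 2 * A + G * (ln 4 + ln s).
exists (Num.truncn (c / (A / 8))).+1 => q n q0q q0 n0 nq.
have qR : 0 < q%:R :> R by rewrite ltr0n.
have cq : c <= A / 8 * q%:R.
  rewrite mulrC -ler_pdivrMr ?divr_gt0//.
  by apply: (le_trans (ltW (truncnS_gt _))); rewrite ler_nat.
have lnq : G * ln q%:R <= G * ln s + A / 8 * q%:R.
  have : ln (q%:R / s) <= q%:R / s by apply/ltW/ln_sublinear; rewrite divr_gt0.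
  rewrite ln_div ?posrE// => h.
  have : G * (ln q%:R - ln s) <= G * (q%:R / s) by rewrite ler_pM2l.
  have -> : G * (q%:R / s) = A / 8 * q%:R by rewrite /s; field; rewrite !gt_eqF.
  by rewrite mulrBr; lra.
have lnn : 3 * A / 2 * (ln n%:R / ln 2) <= G * (ln 4 + ln q%:R).
  have h := @ln_root_le R _ _ _ n0 q0 nq.
  have h4 : 0 <= ln 4 + ln q%:R :> R by rewrite addr_ge0 ?ln_ge0 ?ler1n.
  have -> : G * (ln 4 + ln q%:R) =
    3 * A / 2 * (M.+1%:R * (ln 4 + ln q%:R) / ln 2) by rewrite /G; ring.
  rewrite ler_pM2l; last by lra.
  rewrite ler_pM2r ?invr_gt0// (le_trans h)// ler_wpM2r// ler_nat.
  exact: leqnSn.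
apply: (@le_trans _ _ (expR K%:R * expR (2 * A - A * q%:R / 4))).
  rewrite ler_wpM2r ?expR_ge0// (le_trans _ (expR_ge1Dx _))//; lra.
rewrite -expRD ler_expR /log2; move: cq; rewrite /c; lra.
Qed.

Lemma ln_count_le (R : realType) (n q K N d : nat) : (0 < q)%N -> (1 < n)%N ->
  ((q ^ n) ^ K <= N * (n ^ 2).+1 ^ K * (2 ^ n * q ^ d) ^ K)%N ->
  K%:R * (n%:R * ln q%:R - d%:R * ln q%:R - 3 * ln n%:R - n%:R * ln 4) <=
  ln N%:R :> R.
Proof.
move=> q0 n1 count.
have n0 : (0 < n)%N by exact: ltnW.
have N0 : (0 < N)%N.
  case: N count => //; rewrite !mul0n leqn0 !expn_eq0 => /andP[/andP[/eqP q00]].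
  by rewrite q00 in q0.
have qR : 0 < q%:R :> R by rewrite ltr0n.
have nR : 0 < n%:R :> R by rewrite ltr0n.
have NR : 0 < N%:R :> R by rewrite ltr0n.
(* Rounding [(n ^ 2).+1] up to [n ^ 3] and 2 up to 4 leaves only the logarithms of [n], [q] and 4,
   the same constant as in [ln_root_le]. *)
have count' : ((q ^ n) ^ K <= N * (n ^ 3) ^ K * (4 ^ n * q ^ d) ^ K)%N.
  apply: (leq_trans count); have [->//|K0] := posnP K.
  rewrite leq_mul ?leq_mul ?leq_exp2r//.
    by rewrite expnS; nia.
  by rewrite leq_mul2r leq_exp2r// orbT.
have : ((q%:R ^+ n) ^+ K : R) <=
    N%:R * (n%:R ^+ 3) ^+ K * (4 ^+ n * q%:R ^+ d) ^+ K.
  by rewrite -!natrX -!natrM -!natrX -!natrM ler_nat.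
have lnX (x : R) k : 0 < x -> ln (x ^+ k) = k%:R * ln x.
  by move=> x0; rewrite lnXn// mulr_natl.
have Xgt0 (x : R) k : 0 < x -> 0 < x ^+ k by exact: exprn_gt0.
rewrite -ler_ln ?posrE ?mulr_gt0 ?Xgt0 ?mulr_gt0 ?Xgt0//.
rewrite !lnM ?posrE ?mulr_gt0 ?Xgt0 ?mulr_gt0 ?Xgt0//.
rewrite !lnX ?mulr_gt0 ?Xgt0// lnM ?posrE ?Xgt0// !lnX//; lra.
Qed.

(** Here [l], [lq], [c], [lN] stand for the logarithms of [n], [q], 4, [N], and [K] is the number of
    digits. With [t = 1 / M], [lq] is at least [l * t / 2 * (1 - t)], the code distance costs
    another factor [1 - t], and the terms [3 * l] and [n * c] cost [n * l * t ^+ 2 / 2] each. *)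
Lemma rate_arith (R : realType) (n l c lq lN d K : R) :
  0 <= K -> 0 <= n -> 0 <= l -> 0 <= lq ->
  let M := K + 3 in
  l <= 2 * M * (c + lq) -> d <= n / M -> 2 * M ^+ 2 * c <= l ->
  6 * M ^+ 2 <= n -> K * (n * lq - d * lq - 3 * l - n * c) <= lN ->
  1 / 2 * (1 - 7 / M) * (n * l) <= lN.
Proof.
move=> K0 n0 l0 lq0 M hlq hd hc hn; apply: le_trans.
have M3 : 3 <= M by rewrite /M; lra.
have M0 : 0 < M by lra.
pose t := M^-1.
have tM : t * M = 1 by rewrite mulVf// gt_eqF.
have t0 : 0 < t by rewrite invr_gt0.
have t3 : 3 * t <= 1 by have := ler_wpM2l (ltW t0) M3; rewrite tM; lra.
have KE : K = M - 3 by rewrite /M; lra.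
have Kt : K * t = 1 - 3 * t by rewrite KE mulrBl mulrC tM.
rewrite -/t in hd *.
have b1 : l * t / 2 * (1 - t) <= lq.
  have c1 : c <= l * t ^+ 2 / 2.
    have := ler_wpM2l (exprn_ge0 2 (ltW t0)) hc.
    have -> : t ^+ 2 * (2 * M ^+ 2 * c) = 2 * (t * M) ^+ 2 * c by ring.
    by rewrite tM; lra.
  have := ler_wpM2l (ltW t0) hlq.
  have -> : t * (2 * M * (c + lq)) = 2 * (t * M) * (c + lq) by ring.
  rewrite tM; lra.
have b2 : n * c <= n * (l * t ^+ 2 / 2).
  rewrite ler_wpM2l//.
  have := ler_wpM2l (exprn_ge0 2 (ltW t0)) hc.
  have -> : t ^+ 2 * (2 * M ^+ 2 * c) = 2 * (t * M) ^+ 2 * c by ring.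
  by rewrite tM; lra.
have b3 : 3 * l <= n * (l * t ^+ 2 / 2).
  have := ler_wpM2l (exprn_ge0 2 (ltW t0)) hn.
  have -> : t ^+ 2 * (6 * M ^+ 2) = 6 * (t * M) ^+ 2 by ring.
  rewrite tM => h; have := ler_wpM2r l0 h; lra.
have b4 : (1 - t) * n * lq <= n * lq - d * lq.
  have := ler_wpM2r lq0 hd; lra.
have b5 : (1 - t) * n * (l * t / 2 * (1 - t)) <= (1 - t) * n * lq.
  by rewrite ler_wpM2l// mulr_ge0//; lra.
have nl0 : 0 <= n * l * t / 2 by rewrite divr_ge0// !mulr_ge0// ltW.
have b6 : n * l * t / 2 * (1 - 4 * t) <= n * lq - d * lq - 3 * l - n * c.
  have : 0 <= n * l * t / 2 * t ^+ 2 by rewrite mulr_ge0// exprn_ge0// ltW.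
  lra.
apply: le_trans (ler_wpM2l K0 b6).
have -> : K * (n * l * t / 2 * (1 - 4 * t)) =
  n * l / 2 * ((K * t) * (1 - 4 * t)) by ring.
(* What remains is [(1 - 3 * t) * (1 - 4 * t) >= 1 - 7 * t]. *)
rewrite Kt.
have -> : 1 / 2 * (1 - 7 * t) * (n * l) = n * l / 2 * (1 - 7 * t) by ring.
apply: ler_wpM2l; first by rewrite divr_ge0// mulr_ge0.
by have := mulr_ge0 (ltW t0) (ltW t0); lra.
Qed.

Lemma galaxy_rate (R : realType) (n q K N : nat) :
  let M := K.+4 in
  (n < (2 * q.+1) ^ (2 * M))%N -> (2 * M <= q)%N -> (6 * M ^ 2 <= n)%N ->
  2 * M%:R ^+ 2 * ln 4 <= ln n%:R :> R ->
  ((q ^ n) ^ K.+1 <=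
     N * (n ^ 2).+1 ^ K.+1 * (2 ^ n * q ^ (n %/ q).+1) ^ K.+1)%N ->
  1 / 2 * (1 - 7 / M%:R) <= ln N%:R / (n%:R * ln n%:R) :> R.
Proof.
move=> M nq Mq Mn Ml count.
have q0 : (0 < q)%N by apply: leq_trans Mq; rewrite muln_gt0.
have n1 : (1 < n)%N by apply: leq_trans Mn; rewrite /M; nia.
have n0 : (0 < n)%N by exact: ltnW.
have nR : 0 < n%:R :> R by rewrite ltr0n.
have qR : 0 < q%:R :> R by rewrite ltr0n.
have MR : 0 < M%:R :> R by rewrite ltr0n.
have ME : M%:R = K.+1%:R + 3 :> R by rewrite -natrD addn3.
have lnn : 0 < ln n%:R :> R by rewrite ln_gt0// ltr1n.
rewrite ler_pdivlMr ?mulr_gt0//.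
have := @rate_arith R n%:R (ln n%:R) (ln 4) (ln q%:R) (ln N%:R)
  (n %/ q).+1%:R K.+1%:R.
rewrite -ME /=; apply => //.
- by rewrite ltW.
- by rewrite ln_ge0// ler1n.
- by rewrite -natrM; exact: ln_root_le.
- rewrite ler_pdivlMr// -natr1 mulrDl mul1r.
  have h1 : (n %/ q)%:R * M%:R <= n%:R / 2 :> R.
    rewrite ler_pdivlMr// -!natrM ler_nat; apply: leq_trans (leq_trunc_div n q).
    by rewrite -mulnA leq_mul2l mulnC Mq orbT.
  have h2 : M%:R <= n%:R / 2 :> R.
    rewrite ler_pdivlMr// -natrM ler_nat; apply: leq_trans Mn; nia.
  lra.
- by rewrite -natrX -natrM ler_nat.
- exact: ln_count_le.
Qed.

Lemma near_code_rate_ge (R : realType) (A e : R) (L : nat) :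
  0 < A -> (1 <= L)%N -> 0 < e ->
  \forall n \near \oo, exists N : nat,
    has_DI_code (@poisson_channel R A) n N
      (L%:R * DI_error A n) (DI_error A n) /\
    1 / 2 - e <= ln N%:R / (n%:R * ln n%:R).
Proof.
move=> A0 L1 e0.
(* The rate falls short of 1/2 by [7 / (2 * M)], which is below [4 / M <= e]; [K] is fixed before
   [n] grows. *)
pose K := Num.truncn (4 / e); pose M := K.+4.
have Me : 4 / M%:R <= e.
  rewrite ler_pdivrMr ?ltr0n// mulrC -ler_pdivrMr//.
  apply: (le_trans (ltW (truncnS_gt _))).
  by rewrite ler_nat /M -/K; lia.
have [q0 q0P] := code_error_le K.+1 (2 * M) A0.
near=> n.
have n0 : (0 < n)%N by near: n; exact: nbhs_infty_gt.
have M2 : (0 < 2 * M)%N by [].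
have [q /andP[qn nq]] := even_root n M2.
have qq0 : (maxn q0 (2 * M) <= q)%N.
  (* As [q] depends on [n], it is generalised before the threshold on [n] is chosen. *)
  by move: q nq {qn}; near: n; exact: near_root_ge.
have q_gt0 : (0 < q)%N.
  by apply: leq_trans qq0; rewrite leq_max M2 orbT.
have [N [code count]] := galaxy_code (ltW A0) n0 q_gt0 qn.
have err : K.+1%:R * expR (2 * A - A * q%:R / 4) <= DI_error A n.
  by apply: q0P => //; apply: leq_trans qq0; rewrite leq_maxl.
exists N; split.
  apply: has_DI_code_le code.
    by apply: (le_trans err); rewrite ler_peMl ?expR_ge0// ler1n.
  by apply: le_trans err; rewrite ler_peMl ?expR_ge0// ler1n.
have Mn : (6 * M ^ 2 <= n)%N by near: n; exact: nbhs_infty_ge.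
have Ml : 2 * M%:R ^+ 2 * ln 4 <= ln n%:R :> R by near: n; exact: near_ln_ge.
have Mq : (2 * M <= q)%N by apply: leq_trans qq0; rewrite leq_maxr.
apply: le_trans (galaxy_rate nq Mq Mn Ml count).
have : 0 < M%:R^-1 :> R by rewrite invr_gt0 ltr0n.
move: Me; move: (M%:R^-1) => t; lra.
Unshelve. all: by end_near. Qed.

(** * Codes of maximal size and the capacity *)

(** A fixed number of digits stays below rate 1/2. The largest size dominates all these codes,
    giving one sequence without a diagonal choice. The converse bound makes the range finite, yet it
    holds every admissible size once the errors sum to at most 1/8. *)
Definition max_code_size (R : realType) (A : R) (L n : nat) : nat :=
  \max_(N < (DI_size_base A n ^ n).+1 |
    `[< has_DI_code (@poisson_channel R A) n N
          (L%:R * DI_error A n) (DI_error A n) >]) N.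

Lemma max_code_sizeP (R : realType) (A : R) (L n : nat) :
  has_DI_code (@poisson_channel R A) n (max_code_size A L n)
    (L%:R * DI_error A n) (DI_error A n).
Proof.
rewrite /max_code_size; elim/big_ind: _ => [|N N'|N /asboolP//].
  (* The neutral element 0 of the maximum is the size of the empty code, valid for any errors. *)
  have noI : 'I_0 -> False by case.
  by exists (fun i => False_rect _ (noI i)), (fun=> set0) => i; case: (noI i).
by rewrite /maxn; case: ifP.
Qed.

Lemma near_DI_errorD_le (R : realType) (A e : R) (L : nat) : 0 < A -> 0 < e ->
  \forall n \near \oo, L%:R * DI_error A n + DI_error A n <= e.
Proof.
move=> A0 e0; near=> n.
rewrite -{2}[DI_error A n]mul1r -mulrDl natr1 mulrC -ler_pdivlMr ?ltr0n//.
by near: n; apply: near_DI_error_le => //; rewrite divr_gt0.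
Unshelve. all: by end_near. Qed.

Lemma DI_error_cvg0 (R : realType) (A : R) (L : nat) : 0 < A ->
  L%:R * DI_error A n @[n --> \oo] --> (0 : R).
Proof.
move=> A0; apply/cvgrPdist_le => e e0; near=> n.
rewrite sub0r normrN ger0_norm ?mulr_ge0 ?expR_ge0//.
apply: (@le_trans _ _ (L%:R * DI_error A n + DI_error A n)).
  by rewrite lerDl expR_ge0.
by near: n; exact: near_DI_errorD_le.
Unshelve. all: by end_near. Qed.

Lemma max_code_size_rate (R : realType) (A : R) (L : nat) :
  0 < A -> (1 <= L)%N ->
  linearithmic_rate R (max_code_size A L) n @[n --> \oo] --> (1 / 2 : R).
Proof.
move=> A0 L1; apply/cvgrPdist_le => e e0; near=> n.
have n0 : (0 < n)%N by near: n; exact: nbhs_infty_gt.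
have nR : 0 < n%:R :> R by rewrite ltr0n.
have lnn : 0 < ln n%:R :> R.
  by apply: (@lt_le_trans _ _ 1) => //; near: n; exact: near_ln_ge.
have err : L%:R * DI_error A n + DI_error A n <= 1 / 8.
  by near: n; apply: near_DI_errorD_le.
rewrite linearithmic_rateE ler_distlC.
have [N [code rateN]] : exists N : nat,
    has_DI_code (@poisson_channel R A) n N
      (L%:R * DI_error A n) (DI_error A n) /\
    1 / 2 - e <= ln N%:R / (n%:R * ln n%:R).
  by near: n; exact: near_code_rate_ge.
have Nmax : (N <= max_code_size A L n)%N.
  have NQ := DI_code_size_le n0 err code.
  rewrite -ltnS in NQ; apply: (leq_bigmax_cond (Ordinal NQ)).
  exact/asboolP.
apply/andP; split.
  apply: (le_trans rateN); rewrite ler_pM2r ?invr_gt0 ?mulr_gt0//.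
  have [->|N0] := posnP N; last first.
    by rewrite ler_ln ?posrE ?ltr0n ?(leq_trans N0)// ler_nat.
  rewrite ln0//; case: (max_code_size A L n) => [|m]; first by rewrite ln0.
  by rewrite ln_ge0// ler1n.
have upper : forall (m : nat) (l1 l2 : R), l1 + l2 <= 1 / 8 ->
    has_DI_code (@poisson_channel R A) n m l1 l2 ->
    ln m%:R / (n%:R * ln n%:R) <= 1 / 2 + e.
  by near: n; exact: near_rate_le.
exact: upper err (max_code_sizeP A L n).
Unshelve. all: by end_near. Qed.

Theorem theorem13 (R : realType) (A : R) (L : nat)
    (A_gt0 : 0 < A) (L_ge1 : (1 <= L)%N) :
  (exists N : nat -> nat,
     (\forall n \near \oo,
        has_DI_code (@poisson_channel R A) n (N n)
          (L%:R * DI_error A n) (DI_error A n)) /\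
     linearithmic_rate R N n @[n --> \oo] --> (1 / 2 : R)) /\
  is_linearithmic_DI_capacity (@poisson_channel R A) (1 / 2).
Proof.
split.
  exists (max_code_size A L); split; last exact: max_code_size_rate.
  by apply: nearW => n; exact: max_code_sizeP.
split.
  split; first by rewrite divr_gt0.
  (* The case [L = 1] of the construction suffices for the capacity. *)
  exists (max_code_size A 1), (fun n => 1%:R * DI_error A n), (DI_error A).
  split.
  - by move=> n _; exact: max_code_sizeP.
  - exact: DI_error_cvg0.
  - have := DI_error_cvg0 1 A_gt0; under eq_cvg do rewrite mul1r.
    exact.
  - exact: max_code_size_rate.
move=> r [_ [N [l1 [l2 [code l10 l20 rateN]]]]].
apply/ler_addgt0Pr => e e0.
rewrite -(cvg_lim _ rateN)//; apply: limr_le; first by apply/cvg_ex; exists r.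
near=> n; rewrite linearithmic_rateE.
have n0 : (0 < n)%N by near: n; exact: nbhs_infty_gt.
(* Both errors tend to 0, so each is eventually at most 1/16 and the converse applies. *)
have l12 : l1 n + l2 n <= 1 / 8.
  have h1 : `|0 - l1 n| <= 1 / 16.
    by near: n; move/cvgrPdist_le : l10; apply; lra.
  have h2 : `|0 - l2 n| <= 1 / 16.
    by near: n; move/cvgrPdist_le : l20; apply; lra.
  move: h1 h2; rewrite !sub0r !normrN !ler_norml.
  by move=> /andP[_ h1] /andP[_ h2]; lra.
have upper : forall (m : nat) (m1 m2 : R), m1 + m2 <= 1 / 8 ->
    has_DI_code (@poisson_channel R A) n m m1 m2 ->
    ln m%:R / (n%:R * ln n%:R) <= 1 / 2 + e.
  by near: n; exact: near_rate_le.
exact: upper l12 (code n n0).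
Unshelve. all: by end_near. Qed.
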